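(* Let $W_d\in\mathcal{D}$, $\epsilon>0$, $k\in\{1,\dots,m\}$ and $l\in\{1,\dots,n\}$, and let the switches be set so that $s_{kl}=1$ and $s_{ij}=0$ for all $(i,j)\neq(k,l)$. Let $\alpha>0$ and $T>0$ be such that $\alpha T<\frac{2}{\beta}$, where $\beta>0$ is the Lipschitz constant of the memductance functions. Then for any initial condition $\varphi(0)=\varphi_0\in\mathbb{R}^{mn}$, the controller described by the Single-Memristor Algorithm (given in the context) achieves $$|W_{d,kl}-W_{kl}(\varphi_{kl}(\hat T_{kl}))|\le\epsilon$$ for some $\hat T_{kl}\ge 0$, where $\varphi_{kl}(\cdot)$ is the resulting flux trajectory of memristor $M_{kl}$.
   Context: Fix positive integers $m,n$. For $k\in\{1,\dots,m\}$, $l\in\{1,\dots,n\}$ the memristor $M_{kl}$ is described by a function $g_{kl}:\mathbb{R}\to\mathbb{R}$ that is continuously differentiable and strictly monotone, i.e. $(g_{kl}(\varphi)-g_{kl}(\varphi'))(\varphi-\varphi')>0$ for all $\varphi\ne\varphi'$. Its memductance is $W_{kl}(\varphi)=\frac{dg_{kl}}{d\varphi}(\varphi)$. It is assumed that $W_{kl}$ is strictly monotone, i.e. $(W_{kl}(\varphi)-W_{kl}(\varphi'))(\varphi-\varphi')>0$ for all $\varphi\neq\varphi'$, and $\beta$-Lipschitz continuous, i.e. $|W_{kl}(\varphi)-W_{kl}(\varphi')|\le\beta|\varphi-\varphi'|$ for all $\varphi,\varphi'$, for some $\beta>0$. Vectors in $\mathbb{R}^{mn}$ are indexed by pairs $(k,l)$,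 with $\varphi_{kl}$ in position $k+m(l-1)$. The set of desired memductance matrices is $$\mathcal{D}=\{X\in\mathbb{R}_{>0}^{m\times n}\mid \exists\,\varphi\in\mathbb{R}^{mn}\text{ such that }X_{kl}=W_{kl}(\varphi_{kl})\text{ for all }k\in\{1,\dots,m\},\ l\in\{1,\dots,n\}\},$$ where $\mathbb{R}_{>0}^{m\times n}$ denotes the matrices with positive entries. $W_{d,kl}$ is the $(k,l)$ entry of $W_d$. The crossbar array has controlled voltage potentials $P_1^A,\dots,P_n^A$ at the column terminals, and the row terminals are grounded (zero potential). With switch states $s_{ij}\in\{0,1\}$, its dynamics are $$\tfrac{d}{dt}\varphi_{ij}=s_{ij}P_j^A,\qquad -J_i^B=\sum_{j=1}^n W_{ij}(\varphi_{ij})P_j^A s_{ij},$$ where $J_i^B$ is the current measured at row terminal $i$. When only switch $(k,l)$ is closed, this becomes $\frac{d}{dt}\varphi_{kl}=P_l^A$, $\frac{d}{dt}\varphi_{ij}=0$ for $(i,j)\ne(k,l)$, $-J_k^B=W_{kl}(\varphi_{kl})P_l^A$, and $J_i^B=0$ for $i\ne k$. Differential equations with piecewise continuous inputs are understood in integral form. The initial memductances $W_{ij}(\varphi_{ij}(0))$ are assumed known. Single-Memristor Algorithm (with parameters $T>0$, $\alpha>0$, for memristor $M_{kl}$). If $|W_{d,kl}-W_{kl}(\varphi_{kl}(0))|>\epsilon$, then (otherwise nothing is done): 1. Apply $P_l^A(t)=1$ for $t\in[0,T]$. 2. Set $i=1$. 3. Measure $J_k^B(iT)$. 4. If $\left|W_{d,kl}+J_k^B(iT)/P_l^A(iT)\right|\le\epsilon$,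 then stop. 5. Apply $P_l^A(t)=\alpha\left(W_{d,kl}+J_k^B(iT)/P_l^A(iT)\right)$ for $t\in(iT,(i+1)T]$. 6. Set $i=i+1$ and go to step 3. *)

(* Defs.v *)
From mathcomp Require Import all_boot all_order all_algebra.
From mathcomp Require Import all_classical all_reals all_analysis.

Set Implicit Arguments.
Unset Strict Implicit.
Unset Printing Implicit Defensive.

Import Order.TTheory GRing.Theory Num.Theory.
Import numFieldNormedType.Exports.

Local Open Scope classical_set_scope.
Local Open Scope ring_scope.

Definition strictly_monotone (R : realType) (f : R -> R) : Prop :=
  forall x y : R, x != y -> 0 < (f x - f y) * (x - y).

Definition memductance (R : realType) (g : R -> R) : R -> R := derive1 g.

Definition memristor (R : realType) (beta : R) (g : R -> R) : Prop :=
  [/\ (forall x : R, derivable g x 1),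
      continuous (memductance g),
      strictly_monotone g,
      strictly_monotone (memductance g)
    & beta.-lipschitz (memductance g)].

(* Flux vectors of R^(mn) are indexed by pairs (k, l), hence written as m x n
   matrices. *)
Definition desired_memductances (R : realType) (m n : nat)
    (g : 'I_m -> 'I_n -> R -> R) : set 'M[R]_(m, n) :=
  [set X | (forall k l, 0 < X k l) /\
     exists phi : 'M[R]_(m, n),
       forall k l, X k l = memductance (g k l) (phi k l)].

(* Trajectories on [0, +oo[ for constant switch states s, with the flux
   equation in integral form: P j is the potential at column terminal j and
   J i the current at row terminal i; values at negative times are junk. *)
Definition crossbar_trajectory (R : realType) (m n : nat)
    (g : 'I_m -> 'I_n -> R -> R) (s : 'M[bool]_(m, n)) (phi0 : 'M[R]_(m, n))
    (P : 'I_n -> R -> R) (phi : R -> 'M[R]_(m, n)) (J : 'I_m -> R -> R)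
    : Prop :=
  [/\ (forall i j t, 0 <= t ->
         lebesgue_measure.-integrable `[0, t]
           (fun u => ((s i j)%:R * P j u)%:E)),
      (forall i j t, 0 <= t ->
         phi t i j = phi0 i j
           + \int[lebesgue_measure]_(u in `[0, t]) ((s i j)%:R * P j u))
    & (forall i t, 0 <= t ->
         - J i t = \sum_(j < n)
           memductance (g i j) (phi t i j) * P j t * (s i j)%:R)].

(* wd + J(iT) / p(iT): since p(iT) is the value applied on the period ending at
   iT, this is the memductance error at time iT. *)
Definition measured_error (R : realType) (T wd : R) (p J : R -> R) (i : nat)
    : R :=
  wd + J (i%:R * T) / p (i%:R * T).

(* The stopping test |error| <= eps has failed at T, 2T, ..., NT. *)
Definition still_running (R : realType) (eps T wd : R) (p J : R -> R) (N : nat)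
    : Prop :=
  forall i : nat, (0 < i <= N)%N -> eps < `|measured_error T wd p J i|.

(* The voltage p and the measured current J obey the algorithm, where wd and w0
   are the desired and the initial memductance. No voltage is applied when
   nothing is to be done, nor after the algorithm has stopped. *)
Definition single_memristor_algorithm (R : realType) (eps alpha T wd w0 : R)
    (p J : R -> R) : Prop :=
  (`|wd - w0| <= eps -> forall t, 0 <= t -> p t = 0) /\
  (eps < `|wd - w0| ->
    [/\ (forall t, 0 <= t <= T -> p t = 1),
        (forall i : nat, (0 < i)%N -> still_running eps T wd p J i ->
           forall t, i%:R * T < t <= i.+1%:R * T ->
             p t = alpha * measured_error T wd p J i)
      & (forall i : nat, (0 < i)%N -> still_running eps T wd p J i.-1 ->
           `|measured_error T wd p J i| <= eps ->
           forall t, i%:R * T < t -> p t = 0)]).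

Definition closed_loop (R : realType) (m n : nat)
    (g : 'I_m -> 'I_n -> R -> R) (s : 'M[bool]_(m, n)) (k : 'I_m) (l : 'I_n)
    (eps alpha T wd : R) (phi0 : 'M[R]_(m, n))
    (P : 'I_n -> R -> R) (phi : R -> 'M[R]_(m, n)) (J : 'I_m -> R -> R)
    : Prop :=
  crossbar_trajectory g s phi0 P phi J /\
  single_memristor_algorithm eps alpha T wd (memductance (g k l) (phi 0 k l))
    (P l) (J k).

(* Main.v *)
(* With x_i the flux of the selected memristor at time (i + 1) T and W y = w_d,
   the closed loop is the iteration x_(i+1) = x_i + a (W y - W x_i), a = alpha T:
   gradient descent for a convex function whose derivative W - W y is
   beta-Lipschitz.  A monotone beta-Lipschitz W is cocoercive,
   (W y - W x)^2 <= beta (W y - W x) (y - x), so each step decreases (x_i - y)^2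
   by at least a (2 / beta - a) (W y - W x_i)^2.  While the algorithm runs this
   exceeds a fixed positive amount, so it cannot run forever.  The division by
   the applied voltage in the measurement is harmless: that voltage is 1 or
   alpha times an error larger than eps, hence nonzero. *)
Require Import Defs.
From mathcomp Require Import all_boot all_order all_algebra.
From mathcomp Require Import all_classical all_reals all_analysis.
From mathcomp Require Import measurable_realfun zify ring lra.
Set Implicit Arguments.
Unset Strict Implicit.
Unset Printing Implicit Defensive.

Import Order.TTheory GRing.Theory Num.Theory.
Import numFieldNormedType.Exports.
Local Open Scope classical_set_scope.
Local Open Scope ring_scope.

(** * One-dimensional gradient descent *)

Lemma lipschitz_gradient_step (R : realType) (f : R -> R) (beta a y x : R) :
  0 < beta -> strictly_monotone f -> beta.-lipschitz f -> 0 <= a ->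
  (x + a * (f y - f x) - y) ^+ 2
    <= (x - y) ^+ 2 - a * (2 / beta - a) * (f y - f x) ^+ 2.
Proof.
move=> beta0 fmono flip a0.
have lip : `|f y - f x| <= beta * `|y - x| by exact: (flip (y, x)).
have cocoercive : (f y - f x) ^+ 2 / beta <= (f y - f x) * (y - x).
  rewrite ler_pdivrMr// -real_normK ?num_real// expr2.
  (* Monotonicity gives both factors the same sign, so in one dimension cocoercivity is just the
     Lipschitz bound multiplied by [|f y - f x|]. *)
  have -> : (f y - f x) * (y - x) = `|f y - f x| * `|y - x|.
    rewrite -normrM ger0_norm//.
    by have [->|/fmono/ltW//] := eqVneq y x; rewrite !subrr mulr0.
  by rewrite -mulrA ler_wpM2l// mulrC.
have := ler_wpM2l a0 cocoercive.
rewrite -subr_ge0 => h; rewrite -subr_ge0.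
(* After expanding the square, the difference of the two sides is exactly twice the gap in [h]. *)
apply: le_trans (mulr_ge0 (ler0n R 2) h) _.
by rewrite le_eqVlt; apply/orP; left; apply/eqP; ring.
Qed.

Lemma lipschitz_gradient_small (R : realType) (f : R -> R)
    (beta a eps y : R) (x : nat -> R) :
  0 < beta -> strictly_monotone f -> beta.-lipschitz f ->
  0 < a -> a < 2 / beta -> 0 < eps ->
  (forall i, x i.+1 = x i + a * (f y - f (x i))) ->
  exists i, `|f y - f (x i)| <= eps.
Proof.
move=> beta0 fmono flip a0 a_lt eps0 xS.
apply: contrapT => /forallNP large.
(* Guaranteed drop of the squared distance to [y] per step while the error exceeds [eps]; positive
   because [a < 2 / beta]. *)
pose d := a * (2 / beta - a) * eps ^+ 2.
have d0 : 0 < d by rewrite !mulr_gt0 ?subr_gt0 ?exprn_gt0.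
have decr i : (x i - y) ^+ 2 <= (x 0%N - y) ^+ 2 - d * i%:R.
  elim: i => [|i IH]; first by rewrite mulr0 subr0.
  rewrite xS (le_trans (lipschitz_gradient_step y (x i) beta0 fmono flip (ltW a0)))//.
  have : d <= a * (2 / beta - a) * (f y - f (x i)) ^+ 2.
    rewrite ler_pM2l ?mulr_gt0 ?subr_gt0//.
    rewrite -(real_normK (num_real (f y - f (x i)))).
    rewrite lerXn2r ?nnegrE ?(ltW eps0)//.
    by apply: ltW; rewrite ltNge; apply/negP/large.
  by rewrite -natr1; lra.
(* After [N] steps the accumulated drop exceeds the initial squared distance, which would leave a
   negative square. *)
have [N] : exists N, (x 0%N - y) ^+ 2 / d < N%:R.
  by exists (Num.truncn ((x 0%N - y) ^+ 2 / d)).+1; exact: truncnS_gt.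
rewrite ltr_pdivrMr// => hN.
have := decr N; have := sqr_ge0 (x N - y); lra.
Qed.

(** * Integrals of piecewise constant voltages *)

Lemma integral_constant_tail (R : realType) (f : R -> R) (a b c : R) :
  0 <= a -> a <= b -> lebesgue_measure.-integrable `[0, b] (EFin \o f) ->
  (forall u, a < u <= b -> f u = c) ->
  \int[lebesgue_measure]_(u in `[0, b]) f u =
  \int[lebesgue_measure]_(u in `[0, a]) f u + c * (b - a).
Proof.
move=> a0 ab fi fc; apply/eqP; rewrite addrC -subr_eq; apply/eqP.
rewrite Rintegral_itvB ?bnd_simp//.
rewrite (@eq_Rintegral _ _ _ _ _ (cst c)); last first.
  by move=> u; rewrite inE/= in_itv/= => /fc.
rewrite Rintegral_cst//=; congr (c * _).
rewrite lebesgue_measure_itv/= lte_fin.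
by case: ltgtP ab => //= ->; rewrite subrr.
Qed.

(** The ceiling matches the left-open, right-closed periods of the algorithm; the truncated
    predecessor puts [t = 0] into the first period. *)
Definition zero_order_hold (R : realType) (T : R) (v : nat -> R) (t : R) : R :=
  v `|Num.ceil (t / T)|.-1%N.

Section zero_order_hold.
Context (R : realType) (T : R) (v : nat -> R).
Hypothesis T0 : 0 < T.

Lemma zero_order_holdE i t :
  i%:R * T < t <= i.+1%:R * T -> zero_order_hold T v t = v i.
Proof.
rewrite -ltr_pdivlMr// -ler_pdivrMr// => ht; rewrite /zero_order_hold.
rewrite (@ceil_def _ _ i.+1) ?absz_nat//.
by have -> : i.+1%:Z - 1 = i by lia.
Qed.

Lemma zero_order_hold0 t : 0 <= t <= T -> zero_order_hold T v t = v 0%N.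
Proof.
move=> /andP[]; rewrite le_eqVlt => /predU1P[<- _|t0 tT].
  by rewrite /zero_order_hold mul0r ceil0.
by rewrite (zero_order_holdE (i := 0))// mul0r mul1r t0.
Qed.

(** Serves to show that the voltage stays zero at all times after a stop, whichever later period
    they lie in. *)
Lemma zero_order_hold_ex i t : i%:R * T < t ->
  exists2 j, (i <= j)%N & zero_order_hold T v t = v j.
Proof.
rewrite -ltr_pdivlMr// => it; exists `|Num.ceil (t / T)|.-1%N => //.
have : (i%:Z < Num.ceil (t / T)) by rewrite ceil_gt_int.
by case: (Num.ceil _) => n; lia.
Qed.
End zero_order_hold.

Lemma integrable_setU (d : measure_display) (X : measurableType d) (R : realType)
    (mu : {measure set X -> \bar R}) (A B : set X) (f : X -> \bar R) :
  measurable A -> measurable B -> [disjoint A & B] ->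
  mu.-integrable A f -> mu.-integrable B f -> mu.-integrable (A `|` B) f.
Proof.
move=> mA mB AB /integrableP[mfA fA] /integrableP[mfB fB].
have mf : measurable_fun (A `|` B) f by exact/measurable_funU.
apply/integrableP; split => //.
rewrite ge0_integral_setU//; last exact: measurableT_comp.
exact: lte_add_pinfty.
Qed.

Lemma integrable_itv_cst (R : realType) (a b c : R) :
  lebesgue_measure.-integrable `[a, b] (EFin \o cst c).
Proof.
apply: continuous_compact_integrable; first exact: segment_compact.
by apply: continuous_subspaceT => x; exact: cvg_cst.
Qed.

(** Periods are appended one at a time, the signal being constant on each; finitely many of them
    cover [[0, t]]. *)
Lemma integrable_zero_order_hold (R : realType) (T : R) (v : nat -> R) t :
  0 < T -> lebesgue_measure.-integrable `[0, t] (EFin \o zero_order_hold T v).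
Proof.
move=> T0; have period N :
    lebesgue_measure.-integrable `[0, N%:R * T] (EFin \o zero_order_hold T v).
  elim: N => [|N IH].
    rewrite mul0r; apply: eq_integrable (integrable_itv_cst _ _ (v 0%N)) => //.
    move=> u; rewrite inE/= in_itv/= => /andP[u0 u1].
    by rewrite zero_order_hold0// u0 (le_trans u1 (ltW T0)).
  have NT0 : 0 <= N%:R * T by rewrite mulr_ge0// ltW.
  have NT1 : N%:R * T <= N.+1%:R * T by rewrite ler_pM2r// ler_nat.
  rewrite (@itv_bndbnd_setU _ _ _ (BRight (N%:R * T))) ?bnd_simp//.
  apply: integrable_setU => //.
    apply/disj_setPS => u [/=]; rewrite !in_itv/= => /andP[_ u1] /andP[u2 _].
    by have := le_lt_trans u1 u2; rewrite ltxx.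
  apply: (@eq_integrable _ _ _ _ _ _ (EFin \o cst (v N))) => //.
    by move=> u; rewrite inE/= in_itv/= => ?; rewrite (@zero_order_holdE _ _ _ _ N).
  apply: integrableS (integrable_itv_cst (N%:R * T) (N.+1%:R * T) _) => //.
  exact: subset_itv_oc_cc.
apply: integrableS (period (Num.truncn (t / T)).+1) => //.
apply: subset_itvl; rewrite bnd_simp -ler_pdivrMr//; exact/ltW/truncnS_gt.
Qed.

(** * Crossbar trajectories *)

Lemma crossbar_initial (R : realType) (m n : nat) (g : 'I_m -> 'I_n -> R -> R)
    (s : 'M[bool]_(m, n)) (phi0 : 'M[R]_(m, n)) P phi J i j :
  crossbar_trajectory g s phi0 P phi J -> phi 0 i j = phi0 i j.
Proof. by case=> _ -> // _; rewrite set_itv1 Rintegral_set1 addr0. Qed.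

Lemma crossbar_flux_increment (R : realType) (m n : nat)
    (g : 'I_m -> 'I_n -> R -> R) (s : 'M[bool]_(m, n)) (phi0 : 'M[R]_(m, n))
    P phi J i j a b c :
  crossbar_trajectory g s phi0 P phi J -> s i j = true -> 0 <= a -> a <= b ->
  (forall u, a < u <= b -> P j u = c) ->
  phi b i j = phi a i j + c * (b - a).
Proof.
move=> [integr flux _] sij a0 ab Pc; have b0 := le_trans a0 ab.
rewrite !flux// (@integral_constant_tail _ _ a b c) ?addrA//.
  exact: integr.
by move=> u /Pc ->; rewrite sij mul1r.
Qed.

Lemma crossbar_current (R : realType) (m n : nat)
    (g : 'I_m -> 'I_n -> R -> R) (s : 'M[bool]_(m, n)) (phi0 : 'M[R]_(m, n))
    P phi J k l t :
  crossbar_trajectory g s phi0 P phi J -> s k l = true ->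
  (forall i j, (i, j) != (k, l) -> s i j = false) -> 0 <= t ->
  J k t = - (memductance (g k l) (phi t k l) * P l t).
Proof.
move=> [_ _ current] skl s0 t0; rewrite -[LHS]opprK current//; congr (- _).
rewrite (bigD1 l)//= skl mulr1 big1 ?addr0// => j jl.
by rewrite s0 ?mulr0// xpair_eqE eqxx.
Qed.

(** For a prescribed voltage no differential equation has to be solved: the flux is an explicit
    integral and the current is read off from it. All columns may share one signal, since open
    switches mask it. *)
Lemma crossbar_trajectory_zero_order_hold (R : realType) (m n : nat)
    (g : 'I_m -> 'I_n -> R -> R) (s : 'M[bool]_(m, n)) (phi0 : 'M[R]_(m, n))
    (T : R) (v : nat -> R) :
  0 < T ->
  exists phi J, crossbar_trajectory g s phi0 (fun=> zero_order_hold T v) phi J.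
Proof.
move=> T0.
pose phi t : 'M[R]_(m, n) := \matrix_(i, j) (phi0 i j +
  \int[lebesgue_measure]_(u in `[0, t]) ((s i j)%:R * zero_order_hold T v u)).
exists phi, (fun i t => - \sum_(j < n)
  memductance (g i j) (phi t i j) * zero_order_hold T v t * (s i j)%:R).
split=> [i j t _|i j t _|i t _]; last by rewrite opprK.
- under [X in integrable _ _ X]funext => u do rewrite EFinM.
  by apply: integrableZl => //; exact: integrable_zero_order_hold.
- by rewrite mxE.
Qed.

(** * Measured errors and the closed loop *)

Lemma measured_errorE (R : realType) (T wd w : R) (p J : R -> R) i :
  p (i%:R * T) != 0 -> J (i%:R * T) = - (w * p (i%:R * T)) ->
  measured_error T wd p J i = wd - w.
Proof. by move=> p0 JE; rewrite /measured_error JE mulNr mulfK. Qed.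

Lemma still_runningS (R : realType) (eps T wd : R) (p J : R -> R) N :
  still_running eps T wd p J N.+1 <->
  still_running eps T wd p J N /\ eps < `|measured_error T wd p J N.+1|.
Proof.
split=> [run|[run errN] i].
  split=> [i /andP[i0 iN]|]; last by apply: run; rewrite leqnn.
  by apply: run; rewrite i0 leqW.
case/andP=> i0; rewrite leq_eqVlt => /predU1P[->//|iN].
by apply: run; rewrite i0 -ltnS.
Qed.

Section single_memristor.
Context (R : realType) (m n : nat) (g : 'I_m -> 'I_n -> R -> R) (k : 'I_m)
  (l : 'I_n) (s : 'M[bool]_(m, n)) (eps alpha T wd : R) (phi0 : 'M[R]_(m, n)).
Hypotheses (eps0 : 0 < eps) (alpha0 : 0 < alpha) (T0 : 0 < T)
  (skl : s k l = true)
  (s0 : forall i j, (i, j) != (k, l) -> s i j = false).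

Let W := memductance (g k l).

Lemma period_ge0 i : 0 <= i%:R * T.
Proof. by rewrite mulr_ge0// ltW. Qed.

Lemma period_le i : i%:R * T <= i.+1%:R * T.
Proof. by rewrite ler_pM2r// ler_nat. Qed.

Lemma closed_loop_reaches P phi J (beta y : R) :
  0 < beta -> strictly_monotone W -> beta.-lipschitz W -> wd = W y ->
  alpha * T < 2 / beta ->
  closed_loop g s k l eps alpha T wd phi0 P phi J ->
  exists2 t, 0 <= t & `|wd - W (phi t k l)| <= eps.
Proof.
move=> beta0 Wmono Wlip wdE aT [traj [_ algo]].
apply: contrapT => never.
have large t : 0 <= t -> eps < `|wd - W (phi t k l)|.
  by move=> t0; rewrite ltNge; apply/negP => small; apply: never; exists t.
have [start step _] := algo (large _ (lexx 0)).
have err i : P l (i%:R * T) != 0 ->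
    measured_error T wd (P l) (J k) i = wd - W (phi (i%:R * T) k l).
  move=> P0; apply: measured_errorE => //.
  exact: crossbar_current traj skl s0 (period_ge0 i).
(* Joint induction: a nonzero voltage makes the measured error the true one, which exceeds [eps];
   hence the test fails and the next voltage is again nonzero. *)
have run N : still_running eps T wd (P l) (J k) N /\ P l (N.+1%:R * T) != 0.
  elim: N => [|N [runN PN]].
    split=> [[]//|]; rewrite mul1r start ?oner_neq0// lexx andbT; exact: ltW.
  have eN := err _ PN.
  have runS : still_running eps T wd (P l) (J k) N.+1.
    by apply/still_runningS; split=> //; rewrite eN large// period_ge0.
  split=> //; rewrite (step N.+1)// ?lexx ?andbT ?ltr_pM2r ?ltr_nat//.
  apply: mulf_neq0; first by rewrite gt_eqF.
  by rewrite eN -normr_gt0 (lt_trans eps0)// large// period_ge0.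
have aT0 : 0 < alpha * T by rewrite mulr_gt0.
(* The iteration is sampled from time [T] on, since the first period applies the unit voltage
   instead of feedback. *)
have [i|i] := @lipschitz_gradient_small _ W beta (alpha * T) eps y
  (fun i => phi (i.+1%:R * T) k l) beta0 Wmono Wlip aT0 aT eps0.
  have [runS _] := run i.+1; have [_ Pi] := run i.
  rewrite (crossbar_flux_increment traj skl (period_ge0 _) (period_le _)
    (step i.+1 isT runS)) err// -wdE -mulrBl -natrB// subSnn mul1r.
  by rewrite mulrAC.
by rewrite -wdE leNgt large// period_ge0.
Qed.

(** Uses the true error instead of the measured one, so that fluxes and voltages follow an explicit
    recursion without reference to a current. *)
Definition sampled_voltage (x : R) : R :=
  if `|wd - W x| <= eps then 0 else alpha * (wd - W x).

(* The flux at time (i + 1) T. *)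
Definition sampled_flux (i : nat) : R :=
  iter i (fun x => x + T * sampled_voltage x) (phi0 k l + T).

Definition voltage_samples (i : nat) : R :=
  if i is j.+1 then sampled_voltage (sampled_flux j) else 1.

(** A flux that passes the stopping test receives zero voltage and is a fixed point, so the
    memoryless rule [sampled_voltage] reproduces a permanent stop. *)
Lemma sampled_flux_stopped i j :
  `|wd - W (sampled_flux i)| <= eps -> (i <= j)%N ->
  sampled_flux j = sampled_flux i.
Proof.
move=> stop /subnK <-; elim: (j - i)%N => [//|d IH]; rewrite addSn.
by rewrite [LHS]iterS -/(sampled_flux _) IH /sampled_voltage stop mulr0 addr0.
Qed.

(** Shows that the convergence claim is not vacuous. The voltages are computed in advance by the
    recursion and held over the periods; the resulting trajectory is then checked to obey the
    algorithm. *)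
Lemma closed_loop_exists :
  exists P phi J, closed_loop g s k l eps alpha T wd phi0 P phi J.
Proof.
have [small|large] := leP `|wd - W (phi0 k l)| eps.
  have [phi [J traj]] :=
    crossbar_trajectory_zero_order_hold g s phi0 (fun=> 0) T0.
  exists (fun=> zero_order_hold T (fun=> 0)), phi, J; split=> //.
  by rewrite (crossbar_initial _ _ traj); split=> //; rewrite ltNge small.
have [phi [J traj]] :=
  crossbar_trajectory_zero_order_hold g s phi0 voltage_samples T0.
exists (fun=> zero_order_hold T voltage_samples), phi, J; split=> //.
rewrite (crossbar_initial _ _ traj).
set p := zero_order_hold T voltage_samples.
have pE i t : i%:R * T < t <= i.+1%:R * T -> p t = voltage_samples i.
  exact: zero_order_holdE.
have pT i : p (i.+1%:R * T) = voltage_samples i.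
  by rewrite (pE i)// lexx andbT ltr_pM2r// ltr_nat.
have flux i : phi (i.+1%:R * T) k l = sampled_flux i.
  have flux_step j :
      phi (j.+1%:R * T) k l = phi (j%:R * T) k l + T * voltage_samples j.
    rewrite (crossbar_flux_increment traj skl (period_ge0 j) (period_le j)
      (@pE j)).
    by rewrite -mulrBl -natrB// subSnn mul1r [T * _]mulrC.
  elim: i => [|i IH]; rewrite flux_step.
    by rewrite mul0r (crossbar_initial _ _ traj) mulr1.
  by rewrite IH.
(* Restricted to the running phase: once the voltage is zero, division returns the default 0 and the
   measured error becomes [wd]. *)
have err i : still_running eps T wd p (J k) i ->
    measured_error T wd p (J k) i.+1 = wd - W (sampled_flux i).
  elim: i => [|i IH] run; rewrite -flux; apply: measured_errorE;
    rewrite -?(crossbar_current traj skl s0 (period_ge0 _))// pT/= ?oner_neq0//.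
  have [runi] := (still_runningS _ _ _ _ _ _).1 run; rewrite IH// => large_i.
  rewrite /sampled_voltage leNgt large_i/=.
  apply: mulf_neq0; first by rewrite gt_eqF.
  by rewrite -normr_gt0 (lt_trans eps0).
split; first by rewrite leNgt large.
move=> _; split=> [t|[//|i] _ run t /pE ->|[//|i] _ run].
- exact: zero_order_hold0.
- have [runi] := (still_runningS _ _ _ _ _ _).1 run.
  by rewrite err//= /sampled_voltage => large_i; rewrite leNgt large_i.
- rewrite err// => stop t /(zero_order_hold_ex voltage_samples T0).
  rewrite -/p => -[[//|j] ij ->] /=.
  by rewrite /sampled_voltage (sampled_flux_stopped stop ij) stop.
Qed.

End single_memristor.

Theorem theorem2 (R : realType) (m n : nat) (hm : (0 < m)%N) (hn : (0 < n)%N)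
    (g : 'I_m -> 'I_n -> R -> R) (beta : R) (hbeta : 0 < beta)
    (hg : forall i j, memristor beta (g i j))
    (Wd : 'M[R]_(m, n)) (hWd : desired_memductances g Wd)
    (eps : R) (heps : 0 < eps) (k : 'I_m) (l : 'I_n)
    (s : 'M[bool]_(m, n)) (hskl : s k l = true)
    (hs : forall i j, (i, j) != (k, l) -> s i j = false)
    (alpha T : R) (halpha : 0 < alpha) (hT : 0 < T)
    (halphaT : alpha * T < 2 / beta) (phi0 : 'M[R]_(m, n)) :
  (exists (P : 'I_n -> R -> R) (phi : R -> 'M[R]_(m, n)) (J : 'I_m -> R -> R),
     closed_loop g s k l eps alpha T (Wd k l) phi0 P phi J) /\
  (forall (P : 'I_n -> R -> R) (phi : R -> 'M[R]_(m, n)) (J : 'I_m -> R -> R),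
     closed_loop g s k l eps alpha T (Wd k l) phi0 P phi J ->
     exists That : R, 0 <= That /\
       `|Wd k l - memductance (g k l) (phi That k l)| <= eps).
Proof.
have [_ [y Wdy]] := hWd; have [_ _ _ Wmono Wlip] := hg k l.
split; first exact: closed_loop_exists.
move=> P phi J loop.
have [t t0 small] := closed_loop_reaches heps halpha hT hskl hs hbeta Wmono
  Wlip (Wdy k l) halphaT loop.
by exists t.
Qed.
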